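(* Let $k\ge 1$. Any SWF $F$ on a finite set of voters $V$ with $|V|=3k$ and candidate set $C=\{c_1,c_2,c_3\}$ satisfying conditions CC, MIIA, N and TA is an unweighted Borda rule.
   Context: Setting. $V$ is a finite set of voters, $C=\{c_1,c_2,c_3\}$ is the set of candidates, with indices treated modulo $3$. A ballot is a bijection $r:C\to\{0,1,2\}$ ($r^{-1}(2)$ is the highest ranked candidate, $r^{-1}(0)$ the lowest); it is also written as the list of candidates from highest to lowest. $\mathfrak{R}$ is the set of all ballots. The Condorcet cycle is $\mathfrak{C}=\{c_1c_2c_3,\ c_2c_3c_1,\ c_3c_1c_2\}\subset\mathfrak{R}$. An election domain is a subset $E\subset\mathfrak{R}^V$; its elements are elections $e$, with $e(v)$ the ballot of $v$. An election result $\succ$ is a weak ordering of $C$ (ties allowed). A SWF (social welfare function) is a function $F$ from $E$ to the set of weak orderings of $C$. Condition CC: $E=\mathfrak{C}^V$. For $i\ne j$ and $e\in E$ let $\pi_{i,j}(e)\in\mathbb{Z}^V$ be $\pi_{i,j}(e)(v)=e(v)(c_i)-e(v)(c_j)$, and let $A_{i,j}=\pi_{i,j}(E)$. For a result $\succ$, $\pi_{i,j}(\succ)=W$ if $c_i\succ c_j$, $L$ if $c_j\succ c_i$, and $T$ if they are tied. MIIA: for all $i\ne j$ there is a function (relative SWF) $f_{i,j}:A_{i,j}\to\{W,T,L\}$ with $f_{i,j}(\pi_{i,j}(e))=\pi_{i,j}(F(e))$ for all $e\in E$. N (neutrality): for every permutation $\rho$ of $C$ and every $e\in E$ such that the election $\rho\circ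 e$ (obtained by relabelling the candidates in every ballot by $\rho$) lies in $E$, $F(\rho\circ e)=\rho(F(e))$, where $\rho$ acts on weak orderings by relabelling candidates. TA (transitive anonymity): there is a group $G$ acting transitively on $V$ such that $F(g(e))=F(e)$ for all $g\in G$, $e\in E$, where $g(e)(v)=e(g(v))$. Borda rules: for weights $w=(w_v)_{v\in V}\in\mathbb{R}^V$, the Borda rule $B_w$ is the SWF ranking candidates by the score $b_w(c_i,e)=\sum_{v\in V}e(v)(c_i)\,w_v$ (higher score wins, equal scores tie). It is unweighted if $w$ is constant on $V$; up to positive scaling there are three unweighted Borda rules: $w\equiv1$ (positive), $w\equiv-1$ (negative), and $w\equiv0$ (the tie rule, always returning a three-way tie). *)

(* Defs.v *)
From HB Require Import structures.
From mathcomp Require Import all_boot all_order all_algebra all_fingroup.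
From mathcomp Require Import reals.

Set Implicit Arguments.
Unset Strict Implicit.
Unset Printing Implicit Defensive.

Import Order.TTheory GRing.Theory Num.Theory.
Local Open Scope ring_scope.

Definition candidate : predArgType := 'I_3.
Definition c1 : candidate := @Ordinal 3 0 isT.
Definition c2 : candidate := @Ordinal 3 1 isT.
Definition c3 : candidate := @Ordinal 3 2 isT.

(* The positions {0, 1, 2} are also 'I_3, so that a bijection from candidates
   to positions is a permutation; position 2 is the top of the ballot. *)
Definition ballot : predArgType := {perm 'I_3}.

Definition ranking (r : ballot) : seq candidate :=
  [:: (r^-1)%g (@Ordinal 3 2 isT); (r^-1)%g (@Ordinal 3 1 isT);
      (r^-1)%g (@Ordinal 3 0 isT)].

Definition condorcet_cycle : {set ballot} :=
  [set r | ranking r \in [:: [:: c1; c2; c3]; [:: c2; c3; c1]; [:: c3; c1; c2]]].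

Definition election (V : finType) : predArgType := {ffun V -> ballot}.

(* A relation is given by its graph: (a, b) belongs to it when a is ranked at
   least as high as b. *)
Definition is_weak_order (S : {set candidate * candidate}) : bool :=
  [forall a, forall b, ((a, b) \in S) || ((b, a) \in S)] &&
  [forall a, forall b, forall c,
     ((a, b) \in S) && ((b, c) \in S) ==> ((a, c) \in S)].

Definition weak_order : predArgType :=
  {S : {set candidate * candidate} | is_weak_order S}.

Definition prefers (S : weak_order) (a b : candidate) : bool :=
  ((a, b) \in val S) && ((b, a) \notin val S).

Definition domain (V : finType) (E : {set election V}) : predArgType :=
  {e : election V | e \in E}.

Definition swf (V : finType) (E : {set election V}) := domain E -> weak_order.

Definition CC (V : finType) (E : {set election V}) : Prop :=
  E = [set e : election V | [forall v, e v \in condorcet_cycle]].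

Inductive outcome := Win | Tie | Loss.

Definition relative_result (i j : candidate) (S : weak_order) : outcome :=
  if prefers S i j then Win else if prefers S j i then Loss else Tie.

Definition relative_votes (V : finType) (i j : candidate) (e : election V) :
    {ffun V -> int} :=
  [ffun v => (e v i : nat)%:Z - (e v j : nat)%:Z].

Definition relative_domain (V : finType) (E : {set election V})
    (i j : candidate) : predArgType :=
  {x : {ffun V -> int} | x \in [seq relative_votes i j e | e in E]}.

Definition relative_election (V : finType) (E : {set election V})
    (i j : candidate) (e : domain E) : relative_domain E i j :=
  exist _ (relative_votes i j (val e))
    (image_f (relative_votes i j) (valP e)).

Definition MIIA (V : finType) (E : {set election V}) (F : swf E) : Prop :=
  forall i j : candidate, i != j ->
    exists f : relative_domain E i j -> outcome,
      forall e : domain E,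
        f (relative_election i j e) = relative_result i j (F e).

(* The composition law of permutations is (s * t) x = t (s x), so the relabelled
   ballot gives rho c the position that the original one gives c. *)
Definition relabel_election (V : finType) (rho : {perm candidate})
    (e : election V) : election V :=
  [ffun v => (rho^-1 * e v)%g].

Definition relabel_graph (rho : {perm candidate})
    (S : {set candidate * candidate}) : {set candidate * candidate} :=
  [set (rho p.1, rho p.2) | p in S].

Lemma mem_relabel_graph rho S a b :
  ((a, b) \in relabel_graph rho S) = (((rho^-1)%g a, (rho^-1)%g b) \in S).
Proof.
apply/imsetP/idP => [[[x y] Sxy [-> ->]]|Sab]; first by rewrite !permK.
by exists ((rho^-1)%g a, (rho^-1)%g b); rewrite //= !permKV.
Qed.

Lemma relabel_graph_weak_order rho (S : weak_order) :
  is_weak_order (relabel_graph rho (val S)).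
Proof.
have /andP[/forallP tS /forallP trS] := valP S.
apply/andP; split; apply/forallP => a; apply/forallP => b.
  by rewrite !mem_relabel_graph; apply: (forallP (tS _)).
apply/forallP => c; rewrite !mem_relabel_graph.
exact: (forallP (forallP (trS _) _)).
Qed.

Definition relabel_result (rho : {perm candidate}) (S : weak_order) :
    weak_order :=
  exist _ (relabel_graph rho (val S)) (relabel_graph_weak_order rho S).

Definition neutral (V : finType) (E : {set election V}) (F : swf E) : Prop :=
  forall (rho : {perm candidate}) (e : domain E)
    (he : relabel_election rho (val e) \in E),
    F (exist _ (relabel_election rho (val e)) he) = relabel_result rho (F e).

(* The acting group may be infinite, which excludes the library's actions of
   finite groups. *)
Definition is_group_action (G : groupType) (V : Type) (act : G -> V -> V) :
    Prop :=
  (forall v, act 1%g v = v) /\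
  (forall g h v, act (g * h)%g v = act g (act h v)).

Definition is_transitive (G : groupType) (V : Type) (act : G -> V -> V) : Prop :=
  forall u v, exists g, act g u = v.

Definition permute_voters (V : finType) (s : V -> V) (e : election V) :
    election V :=
  [ffun v => e (s v)].

(* F (g (e)) only makes sense if g (e) belongs to the domain, which is
   therefore part of the condition. *)
Definition transitively_anonymous (V : finType) (E : {set election V})
    (F : swf E) : Prop :=
  exists (G : groupType) (act : G -> V -> V),
    [/\ is_group_action act, is_transitive act
      & forall (g : G) (e : domain E),
          exists he : permute_voters (act g) (val e) \in E,
            F (exist _ (permute_voters (act g) (val e)) he) = F e].

Definition borda_score (R : realType) (V : finType) (w : V -> R)
    (c : candidate) (e : election V) : R :=
  \sum_(v : V) (e v c : nat)%:R * w v.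

Definition score_graph (R : realType) (s : candidate -> R) :
    {set candidate * candidate} :=
  [set p | s p.2 <= s p.1].

Lemma score_graph_weak_order (R : realType) (s : candidate -> R) :
  is_weak_order (score_graph s).
Proof.
apply/andP; split; apply/forallP => a; apply/forallP => b.
  by rewrite !inE le_total.
apply/forallP => c; rewrite !inE /=; apply/implyP => /andP[ba cb].
exact: le_trans cb ba.
Qed.

Definition borda (R : realType) (V : finType) (w : V -> R) (e : election V) :
    weak_order :=
  exist _ (score_graph (fun c => borda_score w c e))
    (score_graph_weak_order (fun c => borda_score w c e)).

Definition borda_rule (R : realType) (V : finType) (E : {set election V})
    (w : V -> R) : swf E :=
  fun e => borda w (val e).

Definition unweighted_borda_rule (R : realType) (V : finType)
    (E : {set election V}) (F : swf E) : Prop :=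
  exists w : V -> R,
    (exists a : R, forall v, w v = a) /\ F =1 borda_rule w.
Arguments unweighted_borda_rule R {V E} F.

(* Main.v *)
Require Import Defs.
From mathcomp Require Import all_boot all_order all_algebra all_fingroup.
From mathcomp Require Import reals.
From HB Require Import structures.
From mathcomp Require Import zify ring lra.

Set Implicit Arguments.
Unset Strict Implicit.
Unset Printing Implicit Defensive.

Import Order.TTheory GRing.Theory Num.Theory.
Local Open Scope ring_scope.

(** On the Condorcet cycle, a voter's relative vote between c_i and c_{i+1}
    only says whether c_{i+1} is her top candidate.  So MIIA and the cyclic part
    of neutrality encode F by one function f : {set V} -> {-1, 0, 1}, and F takes
    its values in weak orders exactly when on every partition of V into X, Y, Z
    the values f X, f Y, f Z are all zero or include both 1 and -1.

    The heart of the matter is that f = 0 on sets of size k, |V| = 3k.  On a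
    partition into three such sets,
      f X^2 + f Y^2 + f Z^2 + 3 (f X f Y + f Y f Z + f Z f X) <= 0,
    and averaging gives <f, M f> <= - |f|^2 / 3 for M the normalised adjacency
    operator of the Kneser graph KG(3k, k).  The negative eigenvalues of M are
    -1/2, on the span of the functions X |-> [v in X] - 1/3, and others that are
    >= -1/4.  Transitive anonymity says that f is orthogonal to that eigenspace,
    hence <f, M f> >= - |f|^2 / 4 and f = 0.

    Partitions with a part of size k now give f X = - f Y for disjoint X, Y with
    |X| + |Y| = 2k; this makes f a function of the size, equal to
    f(0) sgn (k - |X|). *)

(** * Rayleigh quotients of triangular symmetric operators *)

Section Rayleigh.
Variables (R : realFieldType) (D : finType).
Local Notation vT := {ffun D -> R^o}.
Implicit Types (f g u v e : vT) (U : {vspace vT}).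

Definition dot f g : R := \sum_d (f d : R) * g d.

Lemma dotC f g : dot f g = dot g f.
Proof. by apply: eq_bigr => d _; rewrite mulrC. Qed.

Lemma dotDl f g h : dot (f + g) h = dot f h + dot g h.
Proof. by rewrite -big_split; apply: eq_bigr => d _; rewrite ffunE mulrDl. Qed.

Lemma dotZl a f g : dot (a *: f) g = a * dot f g.
Proof. by rewrite mulr_sumr; apply: eq_bigr => d _; rewrite ffunE -mulrA. Qed.

Lemma dotDr f g h : dot h (f + g) = dot h f + dot h g.
Proof. by rewrite dotC dotDl !(dotC h). Qed.

Lemma dotZr a f g : dot g (a *: f) = a * dot g f.
Proof. by rewrite dotC dotZl dotC. Qed.

Lemma dotBl f g h : dot (f - g) h = dot f h - dot g h.
Proof. by rewrite dotDl -scaleN1r dotZl mulN1r. Qed.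

Lemma dotBr f g h : dot h (f - g) = dot h f - dot h g.
Proof. by rewrite dotC dotBl !(dotC h). Qed.

Lemma dot0l f : dot 0 f = 0.
Proof. by rewrite -(scale0r 0) dotZl mul0r. Qed.

Lemma dot0r f : dot f 0 = 0.
Proof. by rewrite dotC dot0l. Qed.

Lemma dot_ge0 f : 0 <= dot f f.
Proof. by apply: sumr_ge0 => d _; rewrite -expr2 sqr_ge0. Qed.

Lemma dot_eq0 f : dot f f = 0 -> f = 0.
Proof.
move=> /eqP; rewrite psumr_eq0; last by move=> d _; rewrite -expr2 sqr_ge0.
move=> /allP f0; apply/ffunP => d; rewrite ffunE.
by have := f0 d (mem_index_enum d); rewrite /= mulf_eq0 orbb => /eqP.
Qed.

Lemma dot_span0 f (s : seq vT) :
  {in s, forall e, dot f e = 0} -> {in <<s>>%VS, forall e, dot f e = 0}.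
Proof.
elim: s => [|e s IHs] f0 x; first by rewrite span_nil memv0 => /eqP->; apply: dot0r.
rewrite span_cons => /memv_addP[_ /vlineP[a ->] [y ys ->]].
rewrite dotDr dotZr f0 ?mem_head // mulr0 add0r; apply: IHs => // z zs.
by apply: f0; rewrite inE zs orbT.
Qed.

(** Gram-Schmidt along a basis of [U], without normalisation since [R] need not have square
    roots. *)
Lemma orthogonal_projection U f :
  exists2 p, p \in U & {in U, forall u, dot (f - p) u = 0}.
Proof.
rewrite -(span_basis (vbasisP U)); elim: (tval (vbasis U)) f => [|e s IHs] f.
  by exists 0 => [|u]; rewrite ?mem0v // span_nil memv0 => /eqP->; apply: dot0r.
have [p ps fp] := IHs f; have [q qs eq] := IHs e.
have [eq0|eq0] := eqVneq (e - q) 0.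
  exists p => [|u]; first by rewrite span_cons (subvP (addvSr _ _)).
  rewrite span_cons => /memv_addP[_ /vlineP[a ->] [y ys ->]].
  by rewrite -(subrK q e) eq0 add0r fp // rpredD ?rpredZ.
have sub x : x \in <<s>>%VS -> x \in <<e :: s>>%VS.
  by rewrite span_cons; apply: (subvP (addvSr _ _)).
exists (p + (dot (f - p) (e - q) / dot (e - q) (e - q)) *: (e - q)) => [|u].
  apply: rpredD; [exact: sub | apply/rpredZ/rpredB; last exact: sub].
  by rewrite memv_span ?mem_head.
rewrite span_cons => /memv_addP[_ /vlineP[a ->] [y ys ->]].
have -> : a *: e + y = a *: (e - q) + (a *: q + y).
  by rewrite scalerBr addrA subrK.
have: a *: q + y \in <<s>>%VS by rewrite rpredD ?rpredZ.
move: (a *: q + y) => z zs; move: (e - q) eq eq0 => r eq eq0.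
rewrite opprD addrA dotBl dotZl !dotDr (fp z) // (eq z) // !addr0 !dotZr.
rewrite mulrCA divfK ?subrr //.
by apply: contra_neq eq0 => /dot_eq0.
Qed.

Variables (A : {linear vT -> vT}) (c : R) (B : seq vT).
Hypothesis A_sym : forall f g, dot (A f) g = dot f (A g).

(** [B] is meant to span an exceptional eigenspace, whose eigenvalue may lie below [- c] and which
    orthogonality excludes. The first two conditions keep the property inductive. *)
Definition bounded_below U : Prop :=
  [/\ {subset B <= U}, {in U, forall u, A u \in U}
    & {in U, forall u, {in B, forall b, dot u b = 0} ->
         - c * dot u u <= dot u (A u)}].

Lemma linear_span (s : seq vT) U :
  {in s, forall e, A e \in U} -> {in <<s>>%VS, forall u, A u \in U}.
Proof.
elim: s => [|e s IHs] AU u.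
  by rewrite span_nil memv0 => /eqP->; rewrite linear0 mem0v.
rewrite span_cons => /memv_addP[_ /vlineP[a ->] [y ys ->]].
rewrite linearD linearZ; apply: rpredD; first by rewrite rpredZ ?AU ?mem_head.
by apply: (IHs _ y ys) => x xs; apply: AU; rewrite inE xs orbT.
Qed.

Lemma bounded_below_span :
  {in B, forall b, A b \in <<B>>%VS} -> bounded_below <<B>>.
Proof.
move=> AB; split=> [b|u|u uB uB0]; [exact: memv_span | exact: linear_span |].
by rewrite (dot_eq0 (dot_span0 uB0 uB)) !dot0l mulr0.
Qed.

(* The component [e'] of [e] orthogonal to [U] is an exact eigenvector: as [A] is
   symmetric and preserves [U], [A e' - mu *: e'] is both in [U] and orthogonal
   to it. *)
Lemma bounded_below_addv U e mu : - c <= mu ->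
  A e - mu *: e \in U -> bounded_below U -> bounded_below (U + <[e]>).
Proof.
move=> cmu AeU [BU AU bU].
have AeU' : A e \in (U + <[e]>)%VS.
  by rewrite -(subrK (mu *: e) (A e)) memv_add ?memvZ ?memv_line.
split=> [b bB|_ /memv_addP[u uU [_ /vlineP[a ->] ->]]|].
- by rewrite (subvP (addvSl _ _)) ?BU.
- by rewrite linearD linearZ rpredD ?rpredZ // (subvP (addvSl _ _)) ?AU.
have [q qU eq0] := orthogonal_projection U e; set e' := e - q in eq0.
have Ae' : A e' = mu *: e'.
  have Ae'U : A e' - mu *: e' \in U.
    have -> : A e' - mu *: e' = (A e - mu *: e) - (A q - mu *: q).
      by rewrite linearB scalerBr !opprD !opprK addrACA.
    by apply: rpredB => //; apply: rpredB; [exact: AU | exact: rpredZ].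
  apply/eqP; rewrite -subr_eq0; apply/eqP/dot_eq0.
  by rewrite {1}dotBl dotZl A_sym !eq0 ?AU // mulr0 subrr.
move=> _ /memv_addP[u uU [_ /vlineP[a ->] ->]].
(* The form is diagonal along [U] and [e']. As [e'] is orthogonal to [B], orthogonality to [B]
   concerns the [U] component alone. *)
have -> : u + a *: e = (u + a *: q) + a *: e' by rewrite scalerBr addrA addrAC addrK.
have: u + a *: q \in U by rewrite rpredD ?rpredZ.
move: (u + a *: q) => {u uU} u uU uB.
have {}uB : {in B, forall b, dot u b = 0}.
  by move=> b bB; have := uB b bB; rewrite dotDl dotZl eq0 ?BU // mulr0 addr0.
rewrite [A (u + _)]linearD [A (a *: _)]linearZ Ae' /= !(dotDl, dotDr) !(dotZl, dotZr) eq0 //.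
rewrite (dotC u e') (eq0 u) // (eq0 (A u)) ?AU // !mulr0 !(addr0, add0r).
rewrite mulrDr lerD ?bU // ![a * (a * _)]mulrA -!expr2 mulrCA.
by rewrite ler_wpM2l ?sqr_ge0 // ler_wpM2r ?dot_ge0.
Qed.

Lemma bounded_below_spans U (s : seq vT) mu : - c <= mu ->
    {in s, forall e, A e - mu *: e \in U} ->
  bounded_below U -> bounded_below (U + <<s>>).
Proof.
move=> cmu; elim: s => [|e s IHs] sU bU; first by rewrite span_nil addv0.
rewrite span_cons [(<[e]> + _)%VS]addvC addvA; apply: (bounded_below_addv cmu).
  by rewrite (subvP (addvSl _ _)) ?sU ?mem_head.
by apply: IHs => // x xs; rewrite sU // inE xs orbT.
Qed.
End Rayleigh.

(** * The Kneser graph KG(3k, k) *)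

Lemma card_draws_between (V : finType) (T W : {set V}) k :
  T \subset W -> (#|T| <= k)%N ->
  #|[set Y : {set V} | [&& #|Y| == k, T \subset Y & Y \subset W]]|
    = 'C(#|W| - #|T|, k - #|T|).
Proof.
move=> TW Tk; rewrite -(cardsDS TW) -cards_draws.
rewrite -[RHS](card_in_imset (f := fun Y => T :|: Y)); last first.
  move=> Y Z; rewrite !inE => /andP[YW _] /andP[ZW _] /(congr1 (fun X : {set V} => X :\: T)).
  have dj (X : {set V}) : X \subset W :\: T -> (T :|: X) :\: T = X.
    by rewrite subsetD => /andP[_ XT]; rewrite setDUl setDv set0U; apply/setDidPl.
  by rewrite !dj.
apply: eq_card => Y; rewrite inE; apply/and3P/imsetP.
  case=> /eqP Yk TY YW; exists (Y :\: T); last first.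
    by apply/setP => v; rewrite !inE; have [/(subsetP TY)->|] := boolP (v \in T).
  by rewrite inE setSD //= cardsDS // Yk.
case=> Z; rewrite inE subsetD => /andP[/andP[ZW ZT] /eqP Zk] ->.
split; rewrite ?subsetUl // ?subUset ?TW //.
by rewrite cardsU setIC disjoint_setI0 // cards0 subn0 Zk; lia.
Qed.

(** Expand the product over [v] of [1 - (v \in X :&: T)]; [S] collects the factors from which the
    second term is taken. *)
Lemma disjoint_inclusion_exclusion (R : comNzRingType) (V : finType)
    (X T : {set V}) :
  [disjoint X & T]%:R
    = \sum_(S : {set V} | S \subset T) (-1) ^+ #|S| * (S \subset X)%:R :> R.
Proof.
have -> : [disjoint X & T]%:R
    = \prod_(v : V) (- (v \in X :&: T)%:R + 1) :> R.
  case: (boolP [disjoint X & T]) => [/disjoint_setI0->|].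
    by rewrite big1 // => v _; rewrite inE oppr0 add0r.
  by case/pred0Pn=> v /andP[/= vX vT]; rewrite (bigD1 v) //= !inE vX vT addNr mul0r.
rewrite bigA_distr [RHS]big_mkcond; apply: eq_bigr => S _.
rewrite (eq_bigr (fun v => if v \in S then - (v \in X :&: T)%:R else 1)) //.
rewrite -big_mkcond /= prodrN.
have [ST|/subsetPn[v vS vT]] := ifPn; last first.
  by rewrite (bigD1 v) //= inE (negPf vT) andbF mul0r mulr0.
congr (_ * _); case: (boolP (S \subset X)) => [SX|/subsetPn[v vS vX]].
  by rewrite big1 // => v vS; rewrite inE (subsetP SX) ?(subsetP ST).
by rewrite (bigD1 v) //= inE (negPf vX) mul0r.
Qed.

Section Kneser.
Variables (R : realFieldType) (V : finType) (k : nat).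
Hypothesis cardV : #|V| = (3 * k)%N.
Local Notation vT := {ffun {set V} -> R^o}.

(** Sets of size other than [k] are isolated vertices, so that functions can live on all of
    [{set V}]. *)
Definition kneser_adj (X Y : {set V}) : bool :=
  [&& #|X| == k, #|Y| == k & [disjoint X & Y]].

Lemma kneser_adjC X Y : kneser_adj X Y = kneser_adj Y X.
Proof. by rewrite /kneser_adj disjoint_sym andbCA. Qed.

Definition kneser (f : vT) : vT := [ffun X => \sum_(Y | kneser_adj X Y) f Y].

Lemma kneser_is_linear : linear kneser.
Proof.
move=> a f g; apply/ffunP => X; rewrite !ffunE scaler_sumr -big_split.
by apply: eq_bigr => Y _; rewrite !ffunE.
Qed.
HB.instance Definition _ := GRing.isLinear.Build R vT vT _ kneser kneser_is_linear.

Lemma dot_kneserE f g :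
  dot (kneser f) g = \sum_X \sum_(Y | kneser_adj X Y) f Y * g X.
Proof. by apply: eq_bigr => X _; rewrite ffunE mulr_suml. Qed.

Lemma kneser_sym f g : dot (kneser f) g = dot f (kneser g).
Proof.
rewrite [RHS]dotC !dot_kneserE (exchange_big_dep xpredT) //=.
by apply: eq_bigr => X _; apply: eq_big => Y; rewrite 1?kneser_adjC // mulrC.
Qed.

(** The monomials: those with [#|T| <= j] span the functions of degree at most [j] on the
    [k]-sets. *)
Definition upset (T : {set V}) : vT :=
  [ffun X : {set V} => ((#|X| == k) && (T \subset X))%:R].

(** For [j <= k], the number of [k]-sets that contain a given [j]-set and avoid a given [k]-set
    disjoint from it. With the sign [(-1) ^+ j] these are the eigenvalues of the graph; [j = 0]
    gives its degree. *)
Definition kneser_coef j : R := 'C(2 * k - j, k)%:R.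

Lemma kneser_upset (T X : {set V}) : (#|T| <= k)%N ->
  kneser (upset T) X
    = kneser_coef #|T| * ((#|X| == k) && [disjoint X & T])%:R.
Proof.
move=> Tk; rewrite ffunE; have [/eqP Xk|Xk] := boolP (#|X| == k); last first.
  by rewrite big_pred0 ?mulr0 // => Y; rewrite /kneser_adj (negPf Xk).
transitivity
    (\sum_(Y | kneser_adj X Y && ((#|Y| == k) && (T \subset Y))) 1 : R).
  by rewrite [RHS]big_mkcondr; apply: eq_bigr => Y _; rewrite ffunE; case: ifP.
rewrite sumr_const.
have [XT|XT] := boolP [disjoint X & T]; last first.
  rewrite mulr0 eq_card0 // => Y; rewrite !inE /kneser_adj; apply/negP.
  case/andP=> /and3P[_ _ dXY] /andP[_ TY]; case/negP: XT.
  exact: disjointWr TY dXY.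
rewrite mulr1 /kneser_coef; congr _%:R.
have := @card_draws_between _ T (~: X) k; rewrite -disjoints_subset disjoint_sym XT.
move=> /(_ isT Tk); rewrite -[#|~: X|](addnK #|X|) [(#|~: X| + _)%N]addnC cardsC cardV Xk => cE.
have -> : 'C(2 * k - #|T|, k) = 'C(3 * k - k - #|T|, k - #|T|).
  rewrite -[RHS]bin_sub; last lia.
  by congr 'C(_, _); lia.
rewrite -cE; apply: eq_card => Y.
rewrite !inE unfold_in /kneser_adj Xk eqxx /= -disjoints_subset.
by rewrite [in RHS]disjoint_sym; case: (#|Y| == k); rewrite //= andbC.
Qed.

(** Inclusion-exclusion expresses disjointness from [T] through the [upset S] with [S \subset T];
    the term [S = T] is the diagonal one. *)
Lemma kneser_upset_triangular (T : {set V}) : (#|T| <= k)%N ->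
  kneser (upset T) - ((-1) ^+ #|T| * kneser_coef #|T|) *: upset T
    = \sum_(S : {set V} | S \proper T)
         ((-1) ^+ #|S| * kneser_coef #|T|) *: upset S.
Proof.
move=> Tk; apply/eqP; rewrite subr_eq; apply/eqP/ffunP => X.
rewrite kneser_upset // !ffunE -mulnb natrM.
rewrite disjoint_inclusion_exclusion (bigD1 T) //= mulrDr mulrDr.
rewrite addrC sum_ffunE; congr (_ + _); last first.
  by rewrite -mulnb natrM /GRing.scale /=; ring.
rewrite !mulr_sumr; apply: eq_big => S; first by rewrite properEneq andbC.
by rewrite !ffunE -mulnb natrM /GRing.scale /= => _; ring.
Qed.

Hypothesis k_gt0 : (0 < k)%N.

Lemma kneser_coef1 : 2 * kneser_coef 1 = kneser_coef 0.
Proof.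
rewrite /kneser_coef subn0 -natrM; congr _%:R.
have := mul_bin_down (2 * k) k; rewrite subn1 => E.
by apply/eqP; rewrite -(eqn_pmul2l k_gt0); apply/eqP; nia.
Qed.

(** From [j = 1] to [j = 2] the ratio is (k - 1) / (2k - 1) < 1/2, a second halving after
    [kneser_coef1]. *)
Lemma kneser_coef_ge2 j : (2 <= j)%N -> 4 * kneser_coef j <= kneser_coef 0.
Proof.
move=> j2; rewrite -kneser_coef1 /kneser_coef -!natrM ler_nat.
have le_j : ('C(2 * k - j, k) <= 'C(2 * k - 2, k))%N.
  by apply: leq_bin2l; lia.
have := mul_bin_down (2 * k - 1) k.
have -> : (2 * k - 1).-1 = (2 * k - 2)%N by lia.
have -> : (2 * k - 1 - k = k - 1)%N by lia.
by move=> E; nia.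
Qed.

Lemma kneser_coef_ge0 j : 0 <= kneser_coef j.
Proof. exact: ler0n. Qed.

(* [1 / 3] is the proportion of the [k]-sets that contain a given point. *)
Definition degree_one : seq vT :=
  [seq upset [set v] - 3^-1 *: upset set0 | v <- enum V].

Lemma kneser_upset0 : kneser (upset set0) = kneser_coef 0 *: upset set0.
Proof.
apply/eqP; rewrite -subr_eq0; apply/eqP.
have := @kneser_upset_triangular set0; rewrite cards0 expr0 mul1r => -> //.
by rewrite big1 // => S /proper_card; rewrite cards0 ltn0.
Qed.

(** The only proper subset of a singleton is empty, and [kneser_coef1] makes [3^-1] the multiple of
    [upset set0] that gives an exact eigenvector. *)
Lemma kneser_degree_one v :
  kneser (upset [set v] - 3^-1 *: upset set0)
    = - kneser_coef 1 *: (upset [set v] - 3^-1 *: upset set0).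
Proof.
rewrite linearB linearZ /= kneser_upset0.
have := @kneser_upset_triangular [set v]; rewrite cards1 expr1 => /(_ k_gt0)/eqP.
rewrite (bigD1 set0) /=; last by rewrite properEcard sub0set cards0 cards1.
rewrite big1 => [|S /andP[/proper_card]]; last first.
  by rewrite cards1 ltnS leqn0 cards_eq0 => ->.
rewrite cards0 expr0 addr0 mul1r mulN1r subr_eq => /eqP->.
apply/ffunP => X; rewrite !ffunE -kneser_coef1 /GRing.scale /=.
by field.
Qed.

(** Induction on the degree, each new [upset T] being an eigenvector modulo lower degrees. The base
    [j = 1] consists of the exceptional span and the constants. *)
Lemma kneser_filtration j : (0 < j <= k)%N ->
  exists2 U, bounded_below kneser (kneser_coef 0 / 4) degree_one U
    & forall T : {set V}, (#|T| <= j)%N -> upset T \in U.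
Proof.
elim: j => // -[|j] IHj /= jk.
  have uU : upset set0 \in (<<degree_one>> + <[upset set0]>)%VS.
    by rewrite (subvP (addvSr _ _)) ?memv_line.
  exists (<<degree_one>> + <[upset set0]>)%VS => [|T].
    apply: (bounded_below_addv (@kneser_sym) (mu := kneser_coef 0)).
    - by have := kneser_coef_ge0 0; lra.
    - by rewrite /= kneser_upset0 subrr mem0v.
    apply: bounded_below_span => _ /mapP[v _ ->].
    rewrite /= kneser_degree_one rpredZ // memv_span //.
    by apply/mapP; exists v; rewrite ?mem_enum.
  case: (set_0Vmem T) => [->//|[v vT1]] T1.
  have -> : T = [set v].
    by apply/esym/eqP; rewrite eqEcard sub1set vT1 cards1.
  rewrite -(subrK (3^-1 *: upset set0) (upset _)) rpredD ?rpredZ //.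
  rewrite (subvP (addvSl _ _)) // memv_span //.
  by apply/mapP; exists v; rewrite ?mem_enum.
have [|U bU uU] := IHj; first by rewrite /= ltnW.
pose s := [seq upset T | T : {set V} in [set T : {set V} | #|T| == j.+2]].
exists (U + <<s>>)%VS => [|T].
  apply: (bounded_below_spans (@kneser_sym) (mu := (-1) ^+ j.+2 * kneser_coef j.+2)) bU.
    have := @kneser_coef_ge2 j.+2 isT; have := kneser_coef_ge0 j.+2.
    by rewrite -signr_odd; case: (odd _); rewrite ?expr1 ?expr0; lra.
  move=> _ /imageP[T + ->]; rewrite inE => /eqP Tj.
  rewrite -Tj /= kneser_upset_triangular ?Tj // rpred_sum // => S /proper_card.
  by rewrite Tj => Sj; rewrite rpredZ ?uU.
rewrite leq_eqVlt => /predU1P[Tj|Tj]; last first.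
  by rewrite (subvP (addvSl _ _)) ?uU.
rewrite (subvP (addvSr _ _)) // memv_span //.
by apply/imageP; exists T; rewrite ?inE ?Tj.
Qed.

Lemma kneser_lower_bound (f : vT) :
    (forall X : {set V}, #|X| != k -> f X = 0) ->
    (forall v, \sum_(X : {set V} | v \in X) (f X : R)
               = 3^-1 * \sum_(X : {set V}) (f X : R)) ->
  - (kneser_coef 0 / 4) * dot f f <= dot f (kneser f).
Proof.
move=> f_supp f_deg; have [|U [_ _ bU] uU] := @kneser_filtration k.
  by rewrite k_gt0 leqnn.
apply: bU.
  (* For [#|T| = k], [upset T] is the indicator of the single set [T]. *)
  have -> : f = \sum_(T : {set V} | #|T| == k) (f T : R) *: upset T.
    apply/ffunP => X; rewrite sum_ffunE.
    have [/eqP Xk|Xk] := boolP (#|X| == k); last first.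
      by rewrite f_supp // big1 // => T _; rewrite !ffunE (negPf Xk) scaler0.
    rewrite (bigD1 X) ?Xk //= !ffunE Xk eqxx subxx big1 => [|T /andP[/eqP Tk TX]].
      by rewrite addr0 /GRing.scale /= mulr1.
    rewrite !ffunE; case: (boolP (T \subset X)) => [TsX|]; last by rewrite andbF scaler0.
    by case/eqP: TX; apply/eqP; rewrite eqEcard TsX Tk Xk /=.
  by apply: rpred_sum => T /eqP Tk; rewrite rpredZ ?uU ?Tk.
have dot_upset T : dot f (upset T) = \sum_(X : {set V} | T \subset X) (f X : R).
  rewrite /dot [RHS]big_mkcond; apply: eq_bigr => X _; rewrite ffunE.
  have [_|/f_supp->] := boolP (#|X| == k); last by rewrite mul0r if_same.
  by case: ifP; rewrite ?mulr1 ?mulr0.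
move=> _ /mapP[v _ ->]; rewrite dotBr dotZr !dot_upset.
under eq_bigl do rewrite sub1set.
by rewrite f_deg; under [X in _ - _ * X]eq_bigl do rewrite sub0set; rewrite subrr.
Qed.
End Kneser.

(** * Vanishing under the tripartition inequality *)

Section Vanishing.
Variables (R : realFieldType) (V : finType) (k : nat).
Hypothesis cardV : #|V| = (3 * k)%N.
Local Notation adj := (@kneser_adj V k).
Implicit Types (X Y : {set V}).

Lemma kneser_adj_third X Y : adj X Y -> adj X (~: (X :|: Y)).
Proof.
case/and3P=> /eqP Xk /eqP Yk dXY; rewrite /kneser_adj Xk eqxx /=.
rewrite disjoints_subset setCK subsetUl andbT.
have := cardsC (X :|: Y); rewrite cardsU disjoint_setI0 // cards0 cardV; lia.
Qed.

Lemma disjoint_setC_setU X Y : [disjoint X & Y] -> ~: (X :|: ~: (X :|: Y)) = Y.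
Proof.
rewrite setCU setCK setIC setIUl setICr set0U => dXY.
by apply/setIidPl; rewrite -disjoints_subset disjoint_sym.
Qed.

(** Passing to the third part is an involution on the neighbours of [X]. *)
Lemma sum_kneser_adj_third X (F : {set V} -> R) :
  \sum_(Y | adj X Y) F (~: (X :|: Y)) = \sum_(Y | adj X Y) F Y.
Proof.
rewrite [RHS](reindex_onto (fun Y => ~: (X :|: Y)) (fun Y => ~: (X :|: Y))) /=.
  apply: eq_bigl => Y; apply/idP/andP => [aXY|[aXY /eqP XY]].
    by rewrite kneser_adj_third // disjoint_setC_setU //; case/and3P: aXY.
  by rewrite -XY kneser_adj_third.
by move=> Y /and3P[_ _ dXY]; rewrite disjoint_setC_setU.
Qed.

Hypothesis k_gt0 : (0 < k)%N.

(** Summed over adjacent pairs, the squares give [3 * (kneser_coef 0 * sq)] and the products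
    [9 * co]. So [co] is at most -1/3 of [kneser_coef 0 * sq], and by the Kneser bound at least -1/4
    of it. *)
Lemma tripartite_regular_eq0 (f : {set V} -> R) :
    (forall X, #|X| != k -> f X = 0) ->
    (forall v, \sum_(X : {set V} | v \in X) f X
               = 3^-1 * \sum_(X : {set V}) f X) ->
    (forall X Y, adj X Y -> let Z := ~: (X :|: Y) in
       f X ^+ 2 + f Y ^+ 2 + f Z ^+ 2
       + 3 * (f X * f Y + f Y * f Z + f Z * f X) <= 0) ->
  forall X, f X = 0.
Proof.
move=> f_supp f_deg f_tri.
pose F : {ffun {set V} -> R^o} := [ffun X => f X].
have FE X : F X = f X by rewrite ffunE.
pose sq := \sum_X f X ^+ 2; pose co := \sum_X \sum_(Y | adj X Y) f X * f Y.
have dotF : dot F F = sq by apply: eq_bigr => X _; rewrite FE expr2.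
have dotK : dot F (kneser k F) = co.
  rewrite -kneser_sym dot_kneserE; apply: eq_bigr => X _; apply: eq_bigr => Y _.
  by rewrite !FE mulrC.
have lower : - (kneser_coef R k 0 / 4) * sq <= co.
  rewrite -dotF -dotK; apply: kneser_lower_bound => // [X /f_supp|v].
    by rewrite FE.
  by under eq_bigr do rewrite FE; rewrite f_deg; under [in RHS]eq_bigr do rewrite FE.
have co_gt0 : 0 < kneser_coef R k 0 by rewrite ltr0n bin_gt0; lia.
(* The graph is regular; its degree is read off [kneser_upset] at [set0]. *)
have sq1 : \sum_X \sum_(Y | adj X Y) f X ^+ 2 = kneser_coef R k 0 * sq.
  rewrite mulr_sumr; apply: eq_bigr => X _.
  have [Xk|Xk] := boolP (#|X| == k); last first.
    by rewrite f_supp // expr0n /= mulr0 big1.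
  have := @kneser_upset R V k cardV set0 X; rewrite cards0 => /(_ isT).
  rewrite Xk disjoints_subset setC0 subsetT mulr1 => <-.
  rewrite ffunE mulr_suml; apply: eq_bigr => Y /and3P[_ Yk _].
  by rewrite ffunE Yk sub0set mul1r.
have sq2 : \sum_X \sum_(Y | adj X Y) f Y ^+ 2 = kneser_coef R k 0 * sq.
  rewrite -sq1 (exchange_big_dep xpredT) //=; apply: eq_bigr => X _.
  by apply: eq_bigl => Y; rewrite kneser_adjC.
have thirdr (G : {set V} -> {set V} -> R) :
    \sum_X \sum_(Y | adj X Y) G X (~: (X :|: Y)) = \sum_X \sum_(Y | adj X Y) G X Y.
  by apply: eq_bigr => X _; apply: (sum_kneser_adj_third X (G X)).
have thirdl (G : {set V} -> {set V} -> R) :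
    \sum_X \sum_(Y | adj X Y) G Y (~: (X :|: Y)) = \sum_X \sum_(Y | adj X Y) G X Y.
  rewrite -[RHS]thirdr (exchange_big_dep xpredT) //=; apply: eq_bigr => X _.
  by apply: eq_big => [Y|Y _]; rewrite 1?kneser_adjC // setUC.
have upper : \sum_X \sum_(Y | adj X Y) (f X ^+ 2 + f Y ^+ 2 + f (~: (X :|: Y)) ^+ 2
    + 3 * (f X * f Y + f Y * f (~: (X :|: Y)) + f (~: (X :|: Y)) * f X)) <= 0.
  by apply: sumr_le0 => X _; apply: sumr_le0 => Y /f_tri.
have {}upper : 3 * (kneser_coef R k 0 * sq) + 3 * (3 * co) <= 0.
  apply: le_trans upper; rewrite le_eqVlt; apply/orP; left; apply/eqP.
  pose S (G : {set V} -> {set V} -> R) := \sum_X \sum_(Y | adj X Y) G X Y.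
  have SD G H : S (fun X Y => G X Y + H X Y) = S G + S H.
    by rewrite -big_split; apply: eq_bigr => X _; rewrite big_split.
  have SZ a G : S (fun X Y => a * G X Y) = a * S G.
    by rewrite mulr_sumr; apply: eq_bigr => X _; rewrite mulr_sumr.
  rewrite -[RHS]/(S (fun X Y => _)) !(SD, SZ).
  rewrite /S sq1 sq2 (thirdr (fun _ Y => f Y ^+ 2)) sq2 -/co.
  rewrite (thirdl (fun X Y => f X * f Y)) (thirdr (fun X Y => f Y * f X)).
  have -> : \sum_X \sum_(Y | adj X Y) f Y * f X = co.
    by apply: eq_bigr => X _; apply: eq_bigr => Y _; rewrite mulrC.
  by rewrite -/co; ring.
have sq0 : sq = 0.
  apply/eqP; rewrite eq_le; apply/andP; split; last first.
    by apply: sumr_ge0 => X _; apply: sqr_ge0.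
  rewrite -(pmulr_rle0 _ co_gt0); lra.
move=> X; apply/eqP; rewrite -sqrf_eq0; apply/eqP.
by apply: (psumr_eq0P _ sq0) => // Y _; apply: sqr_ge0.
Qed.
End Vanishing.

(** * Set functions balanced on tripartitions *)

(** The sign triples of the three cyclic comparisons in a weak order: 13 of them, one for each weak
    order on three candidates. *)
Definition balanced (a b c : int) : bool :=
  all (mem [:: -1; 0; 1]) [:: a; b; c] &&
  ([&& a == 0, b == 0 & c == 0]
   || (1 \in [:: a; b; c]) && (-1 \in [:: a; b; c])).

Lemma balancedP (P : int -> int -> int -> Prop) :
    P 0 0 0 -> P 1 (-1) 0 -> P 1 0 (-1) -> P (-1) 1 0 -> P (-1) 0 1 ->
    P 0 1 (-1) -> P 0 (-1) 1 -> P 1 1 (-1) -> P 1 (-1) 1 -> P (-1) 1 1 ->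
    P (-1) (-1) 1 -> P (-1) 1 (-1) -> P 1 (-1) (-1) ->
  forall a b c, balanced a b c -> P a b c.
Proof.
do 13!move=> ?; move=> a b c /andP[/and4P[]]; rewrite !inE => + + + _.
by move=> /or3P[]/eqP-> /or3P[]/eqP-> /or3P[]/eqP->.
Qed.

Lemma balanced_opp a b c : balanced a b c -> a = c -> - b = a.
Proof. by move: a b c; apply: balancedP. Qed.

Lemma exists_card_subset (T : finType) (A : {set T}) m :
  (m <= #|A|)%N -> exists2 B : {set T}, B \subset A & #|B| = m.
Proof.
rewrite -bin_gt0 -cards_draws card_gt0 => /set0Pn[B].
by rewrite inE => /andP[BA /eqP Bm]; exists B.
Qed.

Section BalancedSetFunction.
Variables (V : finType) (k : nat).
Hypotheses (k_gt0 : (0 < k)%N) (cardV : #|V| = (3 * k)%N).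
Variable f : {set V} -> int.
Hypothesis f_bal : forall X Y : {set V}, [disjoint X & Y] ->
  balanced (f X) (f Y) (f (~: (X :|: Y))).
Hypothesis f_trans : forall u v : V, exists2 s : V -> V,
  injective s /\ s u = v & forall X : {set V}, f (s @^-1: X) = f X.
Implicit Types X Y Z : {set V}.

Lemma balanced_card_eq0 X : #|X| = k -> f X = 0.
Proof.
move=> Xk; pose g X : rat := if #|X| == k then (f X)%:~R else 0.
suff: g X = 0 by rewrite /g Xk eqxx => /eqP; rewrite intr_eq0 => /eqP.
apply: (tripartite_regular_eq0 cardV k_gt0) => [Y /negPf|v|Y Z].
- by rewrite /g => ->.
(* Transitivity makes [deg] constant; double counting then gives
   [3 * k * deg v = k * \sum_X g X]. *)
- pose deg v := \sum_(X : {set V} | v \in X) g X.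
  have deg_const u : deg u = deg v.
    have [s [s_inj su] fs] := f_trans u v.
    have [t st ts] := injF_bij s_inj.
    have pre_inj : injective (fun X : {set V} => s @^-1: X).
      apply: (can_inj (g := fun X : {set V} => t @^-1: X)) => Y.
      by apply/setP => w; rewrite !inE ts.
    rewrite /deg (reindex_inj pre_inj); apply: eq_big => [Y|Y _].
      by rewrite inE su.
    by rewrite /g fs card_preimset.
  have : \sum_(u : V) deg u = k%:R * \sum_X g X.
    rewrite /deg (exchange_big_dep xpredT) //= mulr_sumr; apply: eq_bigr => Y _.
    rewrite sumr_const /g; case: eqP => [->|_]; last by rewrite mul0rn mulr0.
    by rewrite mulr_natl.
  rewrite (eq_bigr (fun=> deg v)) // sumr_const cardT -cardE cardV.
  rewrite -[deg v *+ _]mulr_natl natrM -/(deg v) => degE.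
  have k0 : k%:R != 0 :> rat by rewrite pnatr_eq0 -lt0n.
  by apply: (mulfI k0); rewrite mulrCA -degE; field.
case/and3P=> Yk Zk dYZ /=.
have YZk : #|~: (Y :|: Z)| == k.
  have := @kneser_adj_third V k cardV Y Z; rewrite /kneser_adj Yk Zk dYZ.
  by move=> /(_ isT) /and3P[].
rewrite /g Yk Zk YZk; move: (f_bal dYZ); move: (f Y) (f Z) (f (~: _)).
(* On the 13 balanced triples the left-hand side is 0 or -1. *)
by apply: (@balancedP (fun a b c : int => a%:~R ^+ 2 + b%:~R ^+ 2 + c%:~R ^+ 2
  + 3 * (a%:~R * b%:~R + b%:~R * c%:~R + c%:~R * a%:~R) <= 0 :> rat)).
Qed.

Lemma balanced_disjoint X Y : [disjoint X & Y] -> (#|X| + #|Y| = 2 * k)%N -> f Y = - f X.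
Proof.
move=> dXY cXY; have : f (~: (X :|: Y)) = 0.
  apply: balanced_card_eq0; have := cardsC (X :|: Y).
  by rewrite cardsU disjoint_setI0 // cards0 cardV; lia.
move: (f_bal dXY); move: (f X) (f Y) (f (~: _)).
by apply: (@balancedP (fun a b c => c = 0 -> b = - a)).
Qed.

(** Both are opposite to one [Z] of size [2 * k - #|X|], for which [#|X| <= k] leaves room outside
    [X :|: Y]. *)
Lemma balanced_eq_card X Y : #|X| = #|Y| -> (#|X| <= k)%N -> f X = f Y.
Proof.
move=> XY Xk; have [|Z ZXY cZ] := @exists_card_subset V (~: (X :|: Y)) (2 * k - #|X|).
  have := cardsC (X :|: Y); have := cardsU X Y; rewrite cardV; lia.
have dZ (W : {set V}) : W \subset X :|: Y -> [disjoint W & Z].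
  move=> WXY; rewrite disjoint_sym disjoints_subset (subset_trans ZXY) //.
  by rewrite setCS.
apply: oppr_inj; rewrite -(@balanced_disjoint X Z) ?dZ ?subsetUl //; last lia.
by rewrite -(@balanced_disjoint Y Z) ?dZ ?subsetUr //; lia.
Qed.

(* The value on sets of size [k - d - 1] is passed to size [k - d - 2] by a partition
   into parts of sizes [k - 1], [k + d + 2] and [k - d - 1]. *)
Lemma balanced_card_lt X Y : (#|X| < k)%N -> (#|Y| < k)%N -> f X = f Y.
Proof.
suff E d (Z : {set V}) : (d < k)%N -> #|Z| = (k - d.+1)%N ->
    forall W : {set V}, #|W| = k.-1 -> f Z = f W.
  move=> Xk Yk; have [|W _ Wk] := @exists_card_subset V setT k.-1.
    by rewrite cardsT cardV; lia.
  rewrite (E (k.-1 - #|X|)%N X _ _ W) //; [|lia|lia].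
  by rewrite (E (k.-1 - #|Y|)%N Y _ _ W) //; lia.
elim: d Z => [|d IHd] Z dk Zk W Wk; first by apply: balanced_eq_card; lia.
have [|Z' Z'Z Z'k] := @exists_card_subset V (~: Z) (k + d.+2).
  by have := cardsC Z; rewrite cardV; lia.
have dZ : [disjoint Z & Z'] by rewrite disjoint_sym disjoints_subset.
have Z'E : f Z' = - f Z by apply: balanced_disjoint => //; lia.
have [|U UZ Uk] := @exists_card_subset V (~: (Z :|: Z')) (k - 1).
  have := cardsC (Z :|: Z').
  by rewrite cardsU disjoint_setI0 // cards0 cardV; lia.
have UW : f U = f W by apply: balanced_eq_card; lia.
have dU : [disjoint U & Z'].
  rewrite disjoints_subset (subset_trans UZ) // setCS subsetUr //.
have TE : f (~: (U :|: Z')) = f W.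
  apply: (IHd _ _ _ _ Wk); first lia.
  have := cardsC (U :|: Z').
  by rewrite cardsU disjoint_setI0 // cards0 cardV; lia.
(* [U] and the third part both have value [f W], so [f Z'] is its opposite; it is also the opposite
   of [f Z]. *)
rewrite -[f Z]opprK -Z'E -UW; apply: (balanced_opp (f_bal dU)).
by rewrite TE UW.
Qed.

(** Up to size [2 * k], a disjoint set of size [2 * k - #|X|] has the opposite value. Beyond, the
    parts [~: X] and [set0] of a partition share their value and force its opposite on [X]. *)
Lemma balanced_card_gt X : (k < #|X|)%N -> f X = - f set0.
Proof.
move=> kX; have [Xle|Xgt] := leqP #|X| (2 * k).
  have [|Y YX Yk] := @exists_card_subset V (~: X) (2 * k - #|X|).
    by have := cardsC X; rewrite cardV; lia.
  rewrite (@balanced_disjoint Y X); last lia.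
    by rewrite (@balanced_card_lt Y set0) ?cards0 //; lia.
  by rewrite disjoints_subset.
have cX : (#|~: X| < k)%N by have := cardsC X; rewrite cardV; lia.
have dX : [disjoint ~: X & X] by rewrite disjoints_subset.
have cE : f (~: X) = f set0 by apply: balanced_card_lt; rewrite ?cards0.
rewrite -[f X]opprK (balanced_opp (f_bal dX)) cE //.
by rewrite setUC setUCr setCT.
Qed.

Lemma balanced_sg X : f X = f set0 * Num.sg (k%:Z - #|X|%:Z).
Proof.
have [Xk|Xk|Xk] := ltngtP #|X| k.
- by rewrite (@balanced_card_lt X set0) ?cards0 // gtr0_sg ?mulr1 //; lia.
- by rewrite balanced_card_gt // ltr0_sg ?mulrN1 //; lia.
- by rewrite balanced_card_eq0 // Xk subrr sgr0 mulr0.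
Qed.

End BalancedSetFunction.

(** * Elections on the Condorcet cycle *)

(** Candidates and positions are treated as elements of the ring Z/3. *)
Lemma ord3P (P : 'I_3 -> Prop) : P 0 -> P 1 -> P (1 + 1) -> forall i, P i.
Proof.
move=> P0 P1 P2 [[|[|[|//]]] lti].
- by rewrite (_ : Ordinal lti = 0) //; apply: val_inj.
- by rewrite (_ : Ordinal lti = 1) //; apply: val_inj.
- by rewrite (_ : Ordinal lti = 1 + 1) //; apply: val_inj.
Qed.

Lemma cyclic_ballot_inj (t : 'I_3) : injective (fun c : 'I_3 => t - c - 1).
Proof. by move=> c d /addIr/addrI/oppr_inj. Qed.

(* [t], [t + 1], [t + 2] are sent to positions 2, 1, 0. *)
Definition cyclic_ballot (t : 'I_3) : ballot := perm (@cyclic_ballot_inj t).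

Lemma cyclic_ballotE t c : cyclic_ballot t c = t - c - 1.
Proof. by rewrite permE. Qed.

(** The ballot is a reflection of Z/3. *)
Lemma cyclic_ballotV t : ((cyclic_ballot t)^-1)%g = cyclic_ballot t.
Proof.
apply/permP => c; apply: (@perm_inj _ (cyclic_ballot t)).
by rewrite permKV !cyclic_ballotE; ring.
Qed.

Lemma cyclic_ballot_condorcet t : cyclic_ballot t \in condorcet_cycle.
Proof.
rewrite inE /ranking cyclic_ballotV !cyclic_ballotE.
by move: t; apply: ord3P.
Qed.

Lemma condorcet_cycleE r :
  r \in condorcet_cycle -> r = cyclic_ballot ((r^-1)%g (1 + 1)).
Proof.
have E2 : @Ordinal 3 2 isT = 1 + 1 by apply: val_inj.
have E1 : @Ordinal 3 1 isT = 1 by apply: val_inj.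
have E0 : @Ordinal 3 0 isT = 0 by apply: val_inj.
rewrite !inE /ranking E2 E1 E0 => rC; apply: invg_inj; rewrite cyclic_ballotV.
apply/permP; rewrite /c1 /c2 /c3 E2 E1 E0 in rC *.
by case/or3P: rC => /eqP[r2 r1 r0]; apply: ord3P;
  rewrite cyclic_ballotE ?r2 ?r1 ?r0; apply: val_inj.
Qed.

(** [relative_result] as a sign, so that reversal is negation. *)
Definition comparison (S : weak_order) (a b : candidate) : int :=
  (prefers S a b)%:Z - (prefers S b a)%:Z.

Lemma comparison_relative_result S S' a b :
  relative_result a b S = relative_result a b S' ->
  comparison S a b = comparison S' a b.
Proof.
rewrite /relative_result /comparison /prefers.
by do 4!case: (_ \in _).
Qed.

Lemma weak_order_total (S : weak_order) (a b : candidate) :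
  ((a, b) \in val S) || ((b, a) \in val S).
Proof. by have /andP[/forallP/(_ a)/forallP/(_ b)] := valP S. Qed.

Lemma weak_order_trans (S : weak_order) (a b c : candidate) :
  (a, b) \in val S -> (b, c) \in val S -> (a, c) \in val S.
Proof.
have /andP[_ /forallP/(_ a)/forallP/(_ b)/forallP/(_ c)/implyP trS] := valP S.
by move=> ab bc; rewrite trS ?ab.
Qed.

Lemma comparison_ge0 (S : weak_order) (a b : candidate) :
  ((a, b) \in val S) = (0 <= comparison S a b).
Proof.
have := weak_order_total S a b; rewrite /comparison /prefers.
by do 2!case: (_ \in _).
Qed.

Lemma comparisonC S a b : comparison S a b = - comparison S b a.
Proof. by rewrite /comparison opprB. Qed.

(** Weak preference all the way round the cycle, in either direction, forces a three-way tie;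
    otherwise both signs occur. *)
Lemma comparison_balanced S a b c :
  balanced (comparison S a b) (comparison S b c) (comparison S c a).
Proof.
have := (weak_order_total S a b, weak_order_total S b c, weak_order_total S c a).
have := (@weak_order_trans S a b c, @weak_order_trans S b c a, @weak_order_trans S c a b).
have := (@weak_order_trans S a c b, @weak_order_trans S c b a, @weak_order_trans S b a c).
rewrite /comparison /prefers.
case: ((a, b) \in _); case: ((b, a) \in _); case: ((b, c) \in _);
  case: ((c, b) \in _); case: ((c, a) \in _); case: ((a, c) \in _);
  by move=> [[+ +] +] [[+ +] +] [[+ +] +] //; do ?[move=> /(_ isT isT) // | move=> _].
Qed.

Lemma comparison_relabel rho S a b :
  comparison (relabel_result rho S) (rho a) (rho b) = comparison S a b.
Proof. by rewrite /comparison /prefers /= !mem_relabel_graph !permK. Qed.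

(** * The set function encoding the rule *)

Section CyclicElections.
Variable V : finType.
Implicit Types (x y : V -> 'I_3) (X Y : {set V}).

Definition cyclic_election x : election V := [ffun v => cyclic_ballot (x v)].

Definition condorcet_domain : {set election V} :=
  [set e : election V | [forall v, e v \in condorcet_cycle]].

Lemma cyclic_election_domain x : cyclic_election x \in condorcet_domain.
Proof.
by rewrite inE; apply/forallP => v; rewrite ffunE cyclic_ballot_condorcet.
Qed.

Definition cyclic_domain x : domain condorcet_domain :=
  exist _ (cyclic_election x) (cyclic_election_domain x).

Lemma cyclic_domainP (e : domain condorcet_domain) : {x | e = cyclic_domain x}.
Proof.
exists (fun v => (val e v)^-1%g (1 + 1)); apply: val_inj; apply/ffunP => v /=.
rewrite ffunE; apply: condorcet_cycleE.
by have := valP e; rewrite inE => /forallP/(_ v).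
Qed.

Lemma relative_votes_cyclic x i v :
  relative_votes i (i + 1) (cyclic_election x) v
    = 1 - 3 * (x v == i + 1 :> 'I_3)%:R.
Proof.
rewrite !ffunE !cyclic_ballotE; move: (x v) => t; move: i t.
by apply: ord3P; apply: ord3P.
Qed.

Lemma relabel_cyclic (rho : {perm candidate}) (s : 'I_3) x :
    (forall c, rho c = c + s) ->
  relabel_election rho (cyclic_election x) = cyclic_election (fun v => x v + s).
Proof.
move=> rhoE; apply/ffunP => v; rewrite !ffunE; apply/permP => c.
rewrite permM -{2}(permKV rho c) rhoE !cyclic_ballotE.
move: ((rho^-1)%g c) => d; rewrite opprD addrA [x v + s]addrC; ring.
Qed.

Variable F : swf condorcet_domain.
Hypotheses (F_miia : MIIA F) (F_neutral : neutral F).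
Hypothesis F_anonymous : transitively_anonymous F.

(* In this election [X] is the set of the voters whose top candidate is 1, and the
   others have top candidate 0. *)
Definition cyclic_comparison X : int :=
  comparison (F (cyclic_domain (fun v => (v \in X)%:R))) 0 1.

Lemma eq_comparison x y (i j : 'I_3) : i != j ->
    relative_votes i j (cyclic_election x) = relative_votes i j (cyclic_election y) ->
  comparison (F (cyclic_domain x)) i j = comparison (F (cyclic_domain y)) i j.
Proof.
move=> ij xy; apply: comparison_relative_result; have [f fE] := F_miia ij.
by rewrite -!fE; congr f; apply: val_inj.
Qed.

Lemma comparison_shift x (s i j : 'I_3) :
  comparison (F (cyclic_domain (fun v => x v + s))) (i + s) (j + s)
    = comparison (F (cyclic_domain x)) i j.
Proof.
pose rho : {perm candidate} := perm (@addIr _ s).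
have rhoE c : rho c = c + s by rewrite permE.
have dom : relabel_election rho (val (cyclic_domain x)) \in condorcet_domain.
  by rewrite (relabel_cyclic _ rhoE) cyclic_election_domain.
rewrite -!rhoE -[RHS](comparison_relabel rho); congr (comparison _ _ _).
rewrite -(F_neutral dom); congr F; apply: val_inj.
by rewrite /= (relabel_cyclic _ rhoE).
Qed.

(** Rotation by [- i] moves the pair to 0 and 1; by MIIA only the set of voters with 1 on top then
    matters. *)
Lemma comparison_cyclic x (i : 'I_3) :
  comparison (F (cyclic_domain x)) i (i + 1)
    = cyclic_comparison [set v | x v == i + 1].
Proof.
rewrite -(@comparison_shift x (- i)) subrr addrAC subrr add0r.
apply: eq_comparison => //; apply/ffunP => v.
have votesE y : relative_votes 0 1 (cyclic_election y) v = 1 - 3 * (y v == 1)%:R.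
  by have := relative_votes_cyclic y 0 v; rewrite add0r.
by rewrite !votesE inE subr_eq [1 + i]addrC; case: eqP.
Qed.

Lemma cyclic_comparison_balanced X Y : [disjoint X & Y] ->
  balanced (cyclic_comparison X) (cyclic_comparison Y)
           (cyclic_comparison (~: (X :|: Y))).
Proof.
move=> dXY.
(* With these top candidates, the cyclic comparisons of a single result are the values on the three
   parts. *)
pose x v : 'I_3 := if v \in X then 1 else if v \in Y then 1 + 1 else 0.
have EX : [set v | x v == 0 + 1] = X.
  by apply/setP => v; rewrite inE /x; case: (v \in X); case: (v \in Y).
have EY : [set v | x v == 0 + 1 + 1] = Y.
  apply/setP => v; rewrite inE /x.
  by case: (boolP (v \in X)) => [/(disjointFr dXY)->|_] //; case: (v \in Y).
have EZ : [set v | x v == 0 + 1 + 1 + 1] = ~: (X :|: Y).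
  by apply/setP => v; rewrite !inE /x; case: (v \in X); case: (v \in Y).
have S0 : 0 + 1 + 1 + 1 = 0 :> 'I_3 by apply: val_inj.
have := comparison_balanced (F (cyclic_domain x)) 0 (0 + 1) (0 + 1 + 1).
have := comparison_cyclic x (0 + 1 + 1); rewrite EZ S0 => ->.
by rewrite !comparison_cyclic EX EY.
Qed.

Lemma cyclic_comparison_transitive (u v : V) :
  exists2 s : V -> V, injective s /\ s u = v
    & forall X, cyclic_comparison (s @^-1: X) = cyclic_comparison X.
Proof.
have [G [act [[act1 actM] act_trans act_anon]]] := F_anonymous.
have [g guv] := act_trans u v; exists (act g); first split=> //.
  by apply: (can_inj (g := act g^-1%g)) => w; rewrite -actM mulVg act1.
move=> X; rewrite /cyclic_comparison.
have [dom <-] := act_anon g (cyclic_domain (fun v => (v \in X)%:R)).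
congr (comparison (F _) _ _); apply: val_inj.
by apply/ffunP => w; rewrite !ffunE inE.
Qed.

(** * Agreement with a Borda rule *)

Variables (R : realType) (k : nat).
Hypotheses (k_gt0 : (0 < k)%N) (cardV : #|V| = (3 * k)%N).

(** The result between [c1] and [c2] when every ballot is c1 c2 c3: 1, 0 and -1 give the positive,
    tie and negative rules. *)
Definition constant_weight : R := (cyclic_comparison set0)%:~R.

Lemma borda_scoreB x (i : 'I_3) :
  borda_score (fun=> constant_weight) i (cyclic_election x)
    - borda_score (fun=> constant_weight) (i + 1) (cyclic_election x)
  = 3 * constant_weight * (k%:Z - #|[set v | x v == i + 1]|%:Z)%:~R.
Proof.
rewrite /borda_score -!mulr_suml -mulrBl -sumrB.
rewrite (eq_bigr (fun v => (relative_votes i (i + 1) (cyclic_election x) v)%:~R)); last first.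
  by move=> v _; rewrite [in RHS]ffunE rmorphB.
under eq_bigr do rewrite relative_votes_cyclic.
rewrite -rmorph_sum /= sumrB sumr_const cardT -cardE cardV -mulr_sumr.
have -> : \sum_(v : V) (x v == i + 1 :> 'I_3)%:R = #|[set v | x v == i + 1]|%:Z.
  rewrite -natr_sum natz; congr Posz; rewrite -sum1dep_card [RHS]big_mkcond.
  by apply: eq_bigr => v _; case: eqP.
by rewrite !rmorphB /= !rmorphM /=; ring.
Qed.

Lemma sgr_comparison x (i : 'I_3) :
  (Num.sg (comparison (F (cyclic_domain x)) i (i + 1)))%:~R
    = Num.sg (borda_score (fun=> constant_weight) i (cyclic_election x)
              - borda_score (fun=> constant_weight) (i + 1) (cyclic_election x)).
Proof.
rewrite borda_scoreB comparison_cyclic.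
rewrite (balanced_sg k_gt0 cardV cyclic_comparison_balanced cyclic_comparison_transitive).
rewrite -mulrA [RHS]sgrM [Num.sg 3]gtr0_sg // mul1r -rmorphM -intr_sg.
by rewrite !sgrM sgr_id.
Qed.

Lemma cyclic_borda x :
  F (cyclic_domain x) = borda (fun=> constant_weight) (cyclic_election x).
Proof.
apply: val_inj; apply/setP => -[a b]; rewrite comparison_ge0 inE /=.
rewrite -[comparison _ _ _ >= 0]sgr_ge0 -(ler0z R) -[RHS]subr_ge0 -[RHS]sgr_ge0.
(* Distinct candidates are adjacent in Z/3, so the comparisons of [i] with [i + 1] determine the
   weak order. *)
have [->|->|->] : [\/ b = a, b = a + 1 | a = b + 1].
- by move: a b; apply: ord3P; apply: ord3P;
    [ constructor 1 | constructor 2 | constructor 3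
    | constructor 3 | constructor 1 | constructor 2
    | constructor 2 | constructor 3 | constructor 1]; apply: val_inj.
- by rewrite subrr sgr0 /comparison subrr sgr0.
- by rewrite sgr_comparison.
- by rewrite comparisonC sgrN mulrNz sgr_comparison -sgrN opprB.
Qed.

End CyclicElections.

Theorem mainTheorem2 (R : realType) (k : nat) (hk : (1 <= k)%N)
    (V : finType) (hV : #|V| = (3 * k)%N)
    (E : {set election V}) (F : swf E)
    (hCC : CC E) (hMIIA : MIIA F) (hN : neutral F)
    (hTA : transitively_anonymous F) :
  unweighted_borda_rule R F.
Proof.
rewrite /CC -/(condorcet_domain V) in hCC; subst E.
exists (fun=> constant_weight F R); split; first by exists (constant_weight F R).
move=> e; have [x ->] := cyclic_domainP e.
exact: (cyclic_borda hMIIA hN hTA R hk hV x).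
Qed.
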